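(* Let $H=(\mathcal{V},\mathcal{E})$ be an interval hypergraph and $k$ a positive integer. There exists a partition of $\mathcal{E}$ into $k$ parts $\{\mathcal{E}_1,\dots,\mathcal{E}_k\}$ such that for each $1\le i\le k$ the hypergraph $H_i=(\mathcal{V},\mathcal{E}_i)$ has an exact hitting set if and only if there exists a conflict-free colouring of $H$ with $k$ non-zero colours.
   Context: An interval hypergraph is a hypergraph with vertex set $[n]=\{1,\dots,n\}$ whose hyperedges are intervals $\{i,i+1,\dots,j\}$, $i\le j$. An exact hitting set of a hypergraph $(\mathcal{V},\mathcal{F})$ is a set $T\subseteq\mathcal{V}$ with $|T\cap e|=1$ for every $e\in\mathcal{F}$. A function $C:\mathcal{V}\to\{0,1,\dots,k\}$ is a conflict-free colouring of $H$ with $k$ non-zero colours if for every $e\in\mathcal{E}$ there is a non-zero colour $j$ with $|e\cap C^{-1}(j)|=1$. *)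

(* Defs.v *)
From mathcomp Require Import all_boot.

Set Implicit Arguments.
Unset Strict Implicit.
Unset Printing Implicit Defensive.

(* The vertex set is the whole type V, so a hypergraph is given by its set of
   hyperedges. *)
Definition hypergraph (V : finType) := {set {set V}}.

(* The vertex set {1, ..., n} is represented by 'I_n = {0, ..., n - 1}, with
   the same order. *)
Definition interval_hypergraph (n : nat) (E : hypergraph 'I_n) : Prop :=
  forall e, e \in E ->
    exists i j : 'I_n, i <= j /\ e = [set x : 'I_n | i <= x <= j].

Definition exact_hitting_set (V : finType) (F : hypergraph V) (T : {set V})
  : Prop := forall e, e \in F -> #|T :&: e| = 1.

(* Parts are allowed to be empty, as k may exceed the number of hyperedges. *)
Definition partition_into (V : finType) (k : nat) (E : hypergraph V)
    (P : 'I_k -> hypergraph V) : Prop :=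
  \bigcup_(i < k) P i = E /\ forall i j, i != j -> [disjoint P i & P j].

(* The colours {0, ..., k} are 'I_k.+1; colour 0 is "uncoloured". *)
Definition conflict_free_colouring (V : finType) (k : nat) (E : hypergraph V)
    (C : V -> 'I_k.+1) : Prop :=
  forall e, e \in E ->
    exists j : 'I_k.+1, j != ord0 /\ #|e :&: C @^-1: [set j]| = 1.

(* Main.v *)
Require Import Defs.
From mathcomp Require Import all_boot.

(** A conflict-free colouring with [k] non-zero colours amounts to pairwise
    disjoint sets [T_1, ..., T_k] such that every hyperedge meets some [T_i] in
    exactly one vertex; the exact hitting sets of a partition give such a family
    except for disjointness.  Suppose [x] lies in both [A = T_i] and [B = T_j].
    An interval containing [x] meets [A] exactly once iff it avoids the
    neighbours of [x] in [A] on both sides.  Exchanging the parts of [A] and [B]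
    to the right of [x] if needed, we may give to one and the same set the
    farther left neighbour and the farther right neighbour; this set then meets
    exactly once every interval through [x] that [A] or [B] did, so [x] can be
    deleted from the other set.  Intervals avoiding [x] lie on one side of [x]
    and see at most a renaming of the two sets.  The sum of the cardinalities
    drops, so iterating makes the family disjoint. *)

Set Implicit Arguments.
Unset Strict Implicit.
Unset Printing Implicit Defensive.

Definition exactly_hits (V : finType) (T e : {set V}) : bool :=
  #|T :&: e| == 1.

(** A point of [P] outside [Q] lies below all of [Q], and [P] contains everything above it. *)
Lemma up_closed_total (n : nat) (P Q : pred 'I_n) :
    (forall a b : 'I_n, a <= b -> P a -> P b) ->
    (forall a b : 'I_n, a <= b -> Q a -> Q b) ->
  (forall a, P a -> Q a) \/ (forall a, Q a -> P a).
Proof.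
move=> Pup Qup; case: (boolP [forall a, P a ==> Q a]) => [/forallP PQ|].
  by left=> a; apply/implyP.
case/forallPn=> a; rewrite negb_imply => /andP[Pa nQa]; right=> b Qb.
case: (leqP a b) => [/Pup -> // | /ltnW ba].
by rewrite (Qup _ _ ba Qb) in nQa.
Qed.

Definition splice (V : finType) (D L R : {set V}) : {set V} :=
  (L :&: D) :|: (R :\: D).

Lemma in_splice (V : finType) (D L R : {set V}) (y : V) :
  (y \in splice D L R) = (if y \in D then y \in L else y \in R).
Proof. by rewrite !inE; case: (y \in D); rewrite !(andbT, andbF, orbF). Qed.

Lemma splice_same (V : finType) (D A : {set V}) : splice D A A = A.
Proof. by apply/setP=> y; rewrite in_splice; case: ifP. Qed.

Lemma card_splice_swap (V : finType) (D A B : {set V}) :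
  #|splice D A B| + #|splice D B A| = #|A| + #|B|.
Proof.
have cS L R : #|splice D L R| = #|L :&: D| + #|R :\: D|.
  rewrite -(cardsID D (splice D L R)); congr (_ + _); apply: eq_card => y;
  by rewrite !inE; case: (y \in D); rewrite !(andbT, andbF, orbF).
by rewrite !cS -(cardsID D A) -(cardsID D B) addnACA [X in _ + X]addnC addnACA.
Qed.

Lemma exactly_hits_at (V : finType) (T e : {set V}) (x : V) :
    x \in T -> x \in e ->
  exactly_hits T e = [forall y, (y \in T) && (y \in e) ==> (y == x)].
Proof.
move=> xT xe; apply/cards1P/forallP => [[z Tez] y|Tex].
  have mem_z u : u \in T -> u \in e -> u = z.
    by move=> uT ue; apply/set1P; rewrite -Tez inE uT.
  by apply/implyP=> /andP[yT ye]; rewrite (mem_z y) // (mem_z x).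
exists x; apply/setP=> y; rewrite !inE.
by apply/idP/eqP => [/(implyP (Tex y))/eqP // | ->]; rewrite xT.
Qed.

Section Uncross.

Variables (n : nat) (x : 'I_n).

Implicit Types (A B T : {set 'I_n}) (a b : 'I_n).

Let itv a b := [set y : 'I_n | a <= y <= b].
Let D := [set y : 'I_n | y <= x].

(** Says that the left neighbour of [x] in [T], if any, lies before [a]. Comparing neighbours thus
    becomes inclusion of predicates, with no special case when a neighbour is absent. *)
Let missL T a := [forall y : 'I_n, (y \in T) && (a <= y) ==> (x <= y)].
Let missR T b := [forall y : 'I_n, (y \in T) && (y <= b) ==> (y <= x)].

Lemma exactly_hits_itv T a b : x \in T -> a <= x <= b ->
  exactly_hits T (itv a b) = missL T a && missR T b.
Proof.
move=> xT /andP[ax xb]; rewrite (exactly_hits_at xT); last by rewrite inE ax.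
apply/forallP/andP => [Tex | [/forallP mL /forallP mR] y].
  split; apply/forallP=> y; apply/implyP=> /andP[yT ab].
    case: (leqP x y) => // yx; move: (Tex y); rewrite yT inE ab /=.
    by rewrite (leq_trans (ltnW yx) xb) /= => /eqP exy; rewrite exy ltnn in yx.
  case: (leqP y x) => // xy; move: (Tex y); rewrite yT inE ab andbT /=.
  by rewrite (leq_trans ax (ltnW xy)) /= => /eqP exy; rewrite exy ltnn in xy.
apply/implyP; rewrite inE => /and3P[yT ay yb].
move: (mL y) (mR y); rewrite yT ay yb /= => xy yx.
by rewrite -val_eqE eqn_leq yx xy.
Qed.

Lemma missL_total A B :
  (forall a, missL A a -> missL B a) \/ (forall a, missL B a -> missL A a).
Proof.
have up T a b : a <= b -> missL T a -> missL T b.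
  move=> ab /forallP mT; apply/forallP=> y; apply/implyP=> /andP[yT yb].
  by apply: (implyP (mT y)); rewrite yT (leq_trans ab).
by apply: up_closed_total => a b; apply: up.
Qed.

Lemma missR_total A B :
  (forall b, missR A b -> missR B b) \/ (forall b, missR B b -> missR A b).
Proof.
have up T a b : a <= b -> ~~ missR T a -> ~~ missR T b.
  move=> ab; apply: contra => /forallP mT.
  apply/forallP=> y; apply/implyP=> /andP[yT ya].
  by apply: (implyP (mT y)); rewrite yT (leq_trans ya).
(* [missR T] is closed downwards, so the complements are compared. *)
case: (@up_closed_total _ (predC (missR A)) (predC (missR B))) => [||AB|BA].
- by move=> a b; apply: up.
- by move=> a b; apply: up.
- by right=> b; apply: contraLR (AB b).
- by left=> b; apply: contraLR (BA b).
Qed.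

Lemma missL_splice L R a : missL (splice D L R) a = missL L a.
Proof.
apply: eq_forallb => y; rewrite in_splice inE.
by case: (leqP y x) => // /ltnW ->; rewrite !implybT.
Qed.

Lemma missR_splice L R b : missR (splice D L R) b = missR R b.
Proof.
by apply: eq_forallb => y; rewrite in_splice inE; case: ifP; rewrite ?implybT.
Qed.

Let hits2 A B a b := exactly_hits A (itv a b) || exactly_hits B (itv a b).

(** [defR] covers both keeping and exchanging the right-hand parts. [A] has the farther left
    neighbour of [x] and [R1] the farther right one, so the first splice serves all intervals
    through [x]. *)
Lemma hits2_splice A B R1 R2 a b : x \in A -> x \in B ->
    (R1 = A /\ R2 = B) \/ (R1 = B /\ R2 = A) ->
    (forall c, missL B c -> missL A c) ->
    (forall c, missR R2 c -> missR R1 c) ->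
  hits2 A B a b -> hits2 (splice D A R1) (splice D B R2 :\ x) a b.
Proof.
move=> xA xB defR leL leR; rewrite /hits2.
have eqh (T T' : {set 'I_n}) : {in itv a b, T =i T'} ->
    exactly_hits T (itv a b) = exactly_hits T' (itv a b).
  move=> TT'; congr (_ == 1); apply: eq_card => y.
  by rewrite !(in_setI y); case: (boolP (y \in itv a b)) => [/TT' ->|];
    rewrite ?andbF.
(* Intervals left of [x] see [A] and [B] unchanged. *)
case: (ltnP b x) => [bx|xb].
  have eqL L R : {in itv a b, splice D L R =i L}.
    move=> y; rewrite inE in_splice inE => /andP[_ yb].
    by rewrite (leq_trans yb (ltnW bx)).
  rewrite (eqh _ _ (eqL A R1)) (eqh (splice D B R2 :\ x) B) // => y yI.
  rewrite in_setD1 eqL //; case: eqP => // yx.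
  by move: yI; rewrite inE yx leqNgt [X in _ && X]leqNgt bx andbF.
(* Intervals right of [x] see [R1] and [R2], that is, [A] and [B] in some order. *)
case: (ltnP x a) => [xa|ax].
  have eqR L R : {in itv a b, splice D L R =i R}.
    move=> y; rewrite inE in_splice inE => /andP[ay _].
    by rewrite leqNgt (leq_trans xa ay).
  rewrite (eqh _ _ (eqR A R1)) (eqh (splice D B R2 :\ x) R2).
    by case: defR => -[-> ->] //; rewrite orbC.
  move=> y yI; rewrite in_setD1 eqR //; case: eqP => // yx.
  by move: yI; rewrite inE yx leqNgt xa.
have xI : a <= x <= b by rewrite ax.
have xS : x \in splice D A R1 by rewrite in_splice inE leqnn.
rewrite (exactly_hits_itv xA) // (exactly_hits_itv xB) //.
rewrite (exactly_hits_itv xS) // missL_splice missR_splice => hAB.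
have [mL mR] : missL A a /\ missR R1 b.
  case: defR hAB leR => -[-> ->] /orP[] /andP[mL mR] leR.
  - by split.
  - by split; [apply: leL | apply: leR].
  - by split; last apply: leR.
  - by split; first apply: leL.
by rewrite mL mR.
Qed.

Lemma uncross A B : x \in A -> x \in B ->
  exists A' B', #|A'| + #|B'| < #|A| + #|B| /\
    forall a b, hits2 A B a b -> hits2 A' B' a b.
Proof.
(* By symmetry, [A] has the farther left neighbour of [x]. *)
wlog leL : A B / forall c, missL B c -> missL A c => [th xA xB|xA xB].
  case: (missL_total B A) => leL; first exact: th.
  have [B' [A' [ltBA hBA]]] := th _ _ leL xB xA.
  exists B', A'; split; first by rewrite [X in _ < X]addnC.
  by move=> a b hAB; apply: hBA; rewrite /hits2 orbC.
have drop R : x \in splice D B R by rewrite in_splice inE leqnn.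
case: (missR_total B A) => leR.
  exists (splice D A A), (splice D B B :\ x); split.
    by rewrite !splice_same ltn_add2l (cardsD1 x B) xB.
  by move=> a b; apply: hits2_splice => //; left.
(* Here [B] has the farther right neighbour, so the right-hand parts are exchanged. This preserves
   the total size, and deleting [x] lowers it. *)
exists (splice D A B), (splice D B A :\ x); split.
  rewrite -(card_splice_swap D A B) ltn_add2l.
  by rewrite (cardsD1 x (splice D B A)) drop.
by move=> a b; apply: hits2_splice => //; right.
Qed.

End Uncross.

Lemma disjoint_hitting_family (n k : nat) (E : hypergraph 'I_n)
    (T : 'I_k -> {set 'I_n}) :
    interval_hypergraph E ->
    (forall e, e \in E -> exists i, exactly_hits (T i) e) ->
  exists T' : 'I_k -> {set 'I_n},
    (forall i j x, x \in T' i -> x \in T' j -> i = j) /\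
    (forall e, e \in E -> exists i, exactly_hits (T' i) e).
Proof.
move=> hE; have [m] := ubnP (\sum_i #|T i|).
elim: m T => // m IHm T; rewrite ltnS => leTm hT.
case: (boolP [exists i, exists j, exists x,
                [&& x \in T i, x \in T j & i != j]]) => [|disjT]; last first.
  exists T; split=> // i j x xi xj; apply/eqP; apply: contraR disjT => nij.
  by apply/existsP; exists i; apply/existsP; exists j; apply/existsP; exists x;
    rewrite xi xj.
case/existsP=> i /existsP[j /existsP[x /and3P[xi xj nij]]].
have [A [B [ltAB hAB]]] := uncross xi xj.
pose T' l := if l == i then A else if l == j then B else T l.
have T'i : T' i = A by rewrite /T' eqxx.
have T'j : T' j = B by rewrite /T' eq_sym (negbTE nij) eqxx.
have T'l l : l != i -> l != j -> T' l = T l.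
  by rewrite /T' => /negbTE -> /negbTE ->.
apply: (IHm T').
  apply: leq_trans leTm.
  have nji : j != i by rewrite eq_sym.
  have sum2 (S : 'I_k -> {set 'I_n}) : \sum_l #|S l| =
      #|S i| + #|S j| + \sum_(l | (l != i) && (l != j)) #|S l|.
    by rewrite (bigD1 i) //= (bigD1 j) //= addnA.
  rewrite (sum2 T) (sum2 T') T'i T'j.
  rewrite (eq_bigr (fun l => #|T l|)) ?ltn_add2r // => l /andP[li lj].
  by rewrite T'l.
move=> e eE; have [l hl] := hT e eE; have [a [b [_ def_e]]] := hE e eE.
(* The index that hits [e] may switch between [i] and [j]. *)
have viaAB : exactly_hits (T i) e || exactly_hits (T j) e ->
    exists l', exactly_hits (T' l') e.
  rewrite def_e => /hAB/orP[hA|hB]; first by exists i; rewrite T'i.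
  by exists j; rewrite T'j.
have [li|li] := eqVneq l i; first by apply: viaAB; rewrite -li hl.
have [lj|lj] := eqVneq l j; first by apply: viaAB; rewrite -lj hl orbT.
by exists l; rewrite T'l.
Qed.

Lemma colouring_of_family (V : finType) (k : nat) (E : hypergraph V)
    (T : 'I_k -> {set V}) :
    (forall i j x, x \in T i -> x \in T j -> i = j) ->
    (forall e, e \in E -> exists i, exactly_hits (T i) e) ->
  exists C : V -> 'I_k.+1, conflict_free_colouring E C.
Proof.
move=> disjT hT.
(* By disjointness the picked index is the only one, so colour [lift ord0 i] has class exactly
   [T i]; uncovered vertices get colour 0. *)
pose C x := if [pick i | x \in T i] is Some i then lift ord0 i else ord0.
exists C => e /hT[i /eqP hi]; exists (lift ord0 i); split; first by [].
rewrite -hi setIC; congr #|pred_of_set (_ :&: _)|.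
apply/setP=> x; rewrite !inE /C; case: pickP => [j xj|noT].
  rewrite (inj_eq lift_inj); apply/eqP/idP => [<- // | xi].
  exact: disjT xj xi.
by rewrite noT.
Qed.

Lemma partition_of_colouring (V : finType) (k : nat) (E : hypergraph V)
    (C : V -> 'I_k.+1) :
    conflict_free_colouring E C ->
  exists P : 'I_k -> hypergraph V,
    partition_into E P /\ forall i, exists T, exact_hitting_set (P i) T.
Proof.
move=> hC; pose T (i : 'I_k) := C @^-1: [set lift ord0 i].
(* An edge may have several colours occurring exactly once; picking one of them makes the parts
   disjoint. *)
pose P i : hypergraph V :=
  [set e in E | [pick j | exactly_hits (T j) e] == Some i].
exists P; split; [split|].
- apply/setP=> e; apply/bigcupP/idP => [[i _]|eE].
    by rewrite inE => /andP[].
  have [c [c0 hc]] := hC e eE.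
  case: (unliftP ord0 c) c0 hc => [j ->|->] // _ hj.
  case def_i: [pick j | exactly_hits (T j) e] => [i|].
    by exists i; rewrite // inE eE def_i eqxx.
  by move: def_i; case: pickP => // /(_ j); rewrite /exactly_hits setIC hj eqxx.
- move=> i j nij; rewrite -setI_eq0; apply/eqP/setP=> e; rewrite !inE.
  case: eqP => [->|]; last by rewrite andbF.
  rewrite [X in _ && (_ && X)](_ : _ = false) ?andbF //.
  by apply: contraNF nij => /eqP[->].
move=> i; exists (T i) => e; rewrite inE => /andP[_].
by case: pickP => // j hj /eqP[<-]; apply/eqP.
Qed.

Theorem theorem8 (n k : nat) (E : hypergraph 'I_n)
    (hE : interval_hypergraph E) (hk : 0 < k) :
  (exists P : 'I_k -> hypergraph 'I_n,
      partition_into E P /\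
      forall i : 'I_k, exists T : {set 'I_n}, exact_hitting_set (P i) T)
  <->
  (exists C : 'I_n -> 'I_k.+1, conflict_free_colouring E C).
Proof.
split=> [[P [[defE _] hP]] | [C]]; last exact: partition_of_colouring.
(* One hitting set is chosen per part; these may still overlap. *)
have [T hT] := fin_all_exists hP.
have [|T' [disjT' hT']] := @disjoint_hitting_family n k E T hE.
  move=> e; rewrite -defE => /bigcupP[i _ /hT hi].
  by exists i; apply/eqP.
exact: colouring_of_family disjT' hT'.
Qed.
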